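(* For $n\ge1$, if the Riordan graph $G=G_n(g,tg)$ is io-decomposable, then its clique number is $$\omega(G)=\lceil\log_2 n\rceil+1.$$
   Context: Power series have coefficients in $\mathbb{Z}$ (or $\mathbb{Z}_2$); $\equiv$ means congruence mod $2$; $[t^k]u$ is the coefficient of $t^k$ in $u$. For $f(0)=0$, the Riordan graph $G_n(g,f)$ is the simple graph on $[n]=\{1,\dots,n\}$ in which, for $i>j\ge1$, $i$ and $j$ are adjacent iff $[t^{i-2}]\,g f^{\,j-1}\equiv 1$. It is proper if $g(0)\equiv f'(0)\equiv1$. The clique number $\omega(G)$ is the number of vertices in a maximum clique of $G$. A proper Riordan graph $G_n(g,f)$, with odd vertex set $V_o$ and even vertex set $V_e$, is io-decomposable if the induced subgraph $\langle V_o\rangle\cong G_{\lceil n/2\rceil}(g,f)$ via the relabeling $2k-1\mapsto k$ and the induced subgraph $\langle V_e\rangle$ is a null graph (no edges). *)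

(* Defs.v *)
From HB Require Import structures.
From mathcomp Require Import all_boot all_order all_algebra.
Set Implicit Arguments.
Unset Strict Implicit.
Unset Printing Implicit Defensive.
Import GRing.Theory.
Local Open Scope ring_scope.

(* Formal power series over Z, given by their coefficients: [u k] is [t^k]u.  *)
Definition fps := nat -> int.

Definition fps_one : fps := fun k => (k == 0%N)%:R.

Definition fps_t : fps := fun k => (k == 1%N)%:R.

Definition fps_mul (u v : fps) : fps :=
  fun k => \sum_(i < k.+1) u i * v (k - i)%N.

Definition fps_exp (u : fps) (m : nat) : fps := iter m (fps_mul u) fps_one.

Definition fps_deriv (u : fps) : fps := fun k => u k.+1 *+ k.+1.

(* The standing condition f(0) = 0 on Riordan graphs holds for f = tg.        *)
Lemma fps_mul_t_0 (g : fps) : fps_mul fps_t g 0%N = 0.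
Proof. by rewrite /fps_mul big_ord1 /fps_t mul0r. Qed.

(* [i] and [j] are vertex labels, both at least 1, with [j < i].              *)
Definition riordan_entry (g f : fps) (i j : nat) : bool :=
  (fps_mul g (fps_exp f (j - 1)) (i - 2)%N == 1 %[mod 2])%Z.

(* The ordinal [i : 'I_n] stands for the vertex labelled i + 1 of             *)
(* [n] = {1, ..., n}.                                                         *)
Definition label (n : nat) (i : 'I_n) : nat := i.+1.

Definition riordan_graph (n : nat) (g f : fps) : rel 'I_n :=
  fun i j =>
    ((label j < label i)%N && riordan_entry g f (label i) (label j))
    || ((label i < label j)%N && riordan_entry g f (label j) (label i)).

Arguments riordan_graph n g f : clear implicits.

Lemma riordan_graph_sym n g f : symmetric (riordan_graph n g f).
Proof. by move=> i j; rewrite /riordan_graph orbC. Qed.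

Lemma riordan_graph_irrefl n g f : irreflexive (riordan_graph n g f).
Proof. by move=> i; rewrite /riordan_graph ltnn. Qed.

Definition riordan_proper (g f : fps) : Prop :=
  (g 0%N = 1 %[mod 2])%Z /\ (fps_deriv f 0%N = 1 %[mod 2])%Z.

Definition odd_vertices (n : nat) : {set 'I_n} :=
  [set i | odd (label i)].

Definition even_vertices (n : nat) : {set 'I_n} :=
  [set i | ~~ odd (label i)].

Definition induced_iso_via (T U : finType) (G : rel T) (A : {set T})
    (H : rel U) (phi : T -> U) : Prop :=
  [/\ {in A &, injective phi},
      phi @: A = [set: U] &
      {in A &, forall x y, H (phi x) (phi y) = G x y}].

Definition induced_null (T : finType) (G : rel T) (A : {set T}) : Prop :=
  {in A &, forall x y, ~~ G x y}.

Lemma half_lt_uphalf (n : nat) (i : 'I_n) : (i./2 < uphalf n)%N.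
Proof. by rewrite uphalfE; apply: (@half_leq i.+2); rewrite ltnS. Qed.

(* On ordinals, the relabelling 2k - 1 |-> k of labels is 2k - 2 |-> k - 1;   *)
(* [uphalf n] is the ceiling of n / 2. Values on even labels are irrelevant.  *)
Definition odd_relabel (n : nat) (i : 'I_n) : 'I_(uphalf n) :=
  Ordinal (half_lt_uphalf i).

Lemma odd_relabelE (n : nat) (i : 'I_n) (k : nat) :
  (0 < k)%N -> label i = (2 * k - 1)%N -> label (odd_relabel i) = k.
Proof.
case: k => // k _; rewrite /label mulnS mul2n /= addSn subSS subn0 => -[->].
by rewrite doubleK.
Qed.

Definition io_decomposable (n : nat) (g f : fps) : Prop :=
  [/\ riordan_proper g f,
      induced_iso_via (riordan_graph n g f) (odd_vertices n)
        (riordan_graph (uphalf n) g f) (@odd_relabel n) &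
      induced_null (riordan_graph n g f) (even_vertices n)].

Definition is_clique (T : finType) (G : rel T) (A : {set T}) : bool :=
  [forall x in A, forall y in A, (x != y) ==> G x y].

Definition clique_number (T : finType) (G : rel T) : nat :=
  (\max_(A : {set T} | is_clique G A) #|A|)%N.

(* Main.v *)
Require Import Defs.
From mathcomp Require Import all_boot all_order all_algebra.
From mathcomp Require Import zify ring.

Set Implicit Arguments.
Unset Strict Implicit.
Unset Printing Implicit Defensive.
Import GRing.Theory.
Local Open Scope ring_scope.

(** Write G_n for G_n(g, tg). Io-decomposability is a self-similarity: the odd
    vertices of G_n carry a copy of G_m with m = ceil(n / 2), and the even
    vertices are pairwise non-adjacent. Since up_log 2 n = up_log 2 m + 1 for
    n > 1, both bounds follow this halving.

    Upper bound ([io_clique_number_leq], valid for any f in place of tg): a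
    clique has at most one even vertex, and its odd vertices form a clique in
    G_m. Hence the clique number of G_n is at most one more than that of G_m.
    The induction goes on because G_m is an induced subgraph of G_n, so it is
    io-decomposable too ([io_decomposable_leq]).

    Lower bound ([bell_io_clique_number_geq]): the vertices 1, 2, 3, 5, ...,
    2^k + 1, ... of G_n form a clique, and there are up_log 2 n + 1 of them. The
    relabelling 2k - 1 |-> k maps the odd vertices of this list onto the list for
    G_m, so their adjacencies descend to the adjacency of 1 and 2, which is
    g(0) = 1 mod 2. It remains to join the only even vertex 2 to 2^k + 1 for
    k > 0; here f = tg enters. That adjacency is the parity of
    [t^(2^k - 2)] g^2; modulo 2 squaring maps g(t) to g(t^2), so it equals
    [t^(2^(k-1) - 1)] g, the adjacency of 1 and 2^(k-1) + 1
    ([riordan_entry2_bell]). *)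

Lemma is_cliqueP (T : finType) (G : rel T) (A : {set T}) :
  reflect {in A &, forall x y, x != y -> G x y} (is_clique G A).
Proof.
apply: (iffP forall_inP) => [cl x y Ax Ay | cl x Ax].
  by apply/implyP; move/forall_inP: (cl x Ax); apply.
by apply/forall_inP => y Ay; apply/implyP; apply: cl.
Qed.

Lemma clique_leq_number (T : finType) (G : rel T) (A : {set T}) :
  is_clique G A -> (#|A| <= clique_number G)%N.
Proof. by move=> clA; rewrite /clique_number (bigD1 A) //= leq_maxl. Qed.

Lemma clique_number_leq (T : finType) (G : rel T) (k : nat) :
  (forall A : {set T}, is_clique G A -> (#|A| <= k)%N) ->
  (clique_number G <= k)%N.
Proof. by move=> leAk; apply/bigmax_leqP. Qed.

(** A clique meets the complement of [A], where [G] has no edges, in at most one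
    vertex, and [phi] carries the rest of it to a clique of [H]. *)
Lemma clique_number_iso_null (T U : finType) (G : rel T) (H : rel U)
    (A : {set T}) (phi : T -> U) :
  induced_iso_via G A H phi -> induced_null G (~: A) ->
  (clique_number G <= (clique_number H).+1)%N.
Proof.
move=> [phi_inj _ phi_iso] nullA; apply: clique_number_leq => B /is_cliqueP clB.
rewrite -(cardsID A B) -addn1 leq_add //.
  have sBA : {subset B :&: A <= A} by move=> x /setIP[].
  rewrite -(card_in_imset (f := phi)); last exact: sub_in2 phi_inj.
  apply/clique_leq_number/is_cliqueP.
  move=> _ _ /imsetP[x /setIP[Bx Ax] ->] /imsetP[y /setIP[By Ay] ->] neq.
  rewrite phi_iso // clB //.
  by apply: contraNneq neq => ->.
apply/card_le1_eqP => x y /setDP[Bx Ax] /setDP[By Ay].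
apply: contraTeq isT => neq; have := nullA x y; rewrite !inE => /(_ Ax Ay).
by rewrite clB // eq_sym.
Qed.

Lemma odd_verticesC n : even_vertices n = ~: odd_vertices n.
Proof. by apply/setP => i; rewrite !inE. Qed.

(** Adjacency of two labels does not depend on [n], so the graph on [m] vertices
    is induced in the one on [n], and [odd_relabel] commutes with the
    inclusion. *)
Lemma io_decomposable_leq (m n : nat) (g f : fps) :
  (m <= n)%N -> io_decomposable n g f -> io_decomposable m g f.
Proof.
move=> le_mn [gf_proper [_ _ iso] null]; split => //.
- split.
  + move=> i j; rewrite !inE /label /= => oi oj [eqij]; apply: val_inj => /=.
    by lia.
  + apply/setP => k; rewrite !inE; apply/imsetP.
    have lt_km : (k.*2 < m)%N by have := ltn_ord k; lia.
    (* The ordinal k.*2 is the vertex labelled 2(k + 1) - 1, where k + 1 is the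
       label of the ordinal k. *)
    exists (Ordinal lt_km); first by rewrite inE /label /= odd_double.
    by apply: val_inj; rewrite /= doubleK.
  + move=> i j; rewrite !inE => oi oj.
    have := iso (widen_ord le_mn i) (widen_ord le_mn j).
    by rewrite !inE; apply.
- move=> i j; rewrite !inE => ei ej.
  have := null (widen_ord le_mn i) (widen_ord le_mn j).
  by rewrite !inE; apply.
Qed.

Lemma up_log2_uphalf (n : nat) :
  (1 < n)%N -> up_log 2 n = (up_log 2 (uphalf n)).+1.
Proof. by case: n => [|[|n]] // _; rewrite up_log2S. Qed.

Lemma io_clique_number_leq (n : nat) (g f : fps) :
  (1 <= n)%N -> io_decomposable n g f ->
  (clique_number (riordan_graph n g f) <= (up_log 2 n).+1)%N.
Proof.
elim/ltn_ind: n => n IHn n_gt0 io.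
have [n_le1|n_gt1] := leqP n 1.
  apply: clique_number_leq => A _.
  by apply: leq_trans (max_card _) _; rewrite card_ord; lia.
rewrite up_log2_uphalf //; have lt_hn : (uphalf n < n)%N by lia.
have [_ iso] := io; rewrite odd_verticesC => null.
apply: leq_trans (clique_number_iso_null iso null) _.
rewrite ltnS; apply: IHn => //; first by lia.
exact: io_decomposable_leq (ltnW lt_hn) io.
Qed.

Lemma fps_mul1r (u : fps) : fps_mul u fps_one =1 u.
Proof.
move=> k; rewrite /fps_mul big_ord_recr /= subnn mulr1 big1 ?add0r // => i _.
by rewrite /fps_one subn_eq0 leqNgt ltn_ord mulr0.
Qed.

Lemma fps_mul_tS (u : fps) (k : nat) : fps_mul fps_t u k.+1 = u k.
Proof.
rewrite /fps_mul !big_ord_recl /= /fps_t /= mul0r add0r mul1r subSS subn0.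
by rewrite big1 ?addr0 // => i _; rewrite mul0r.
Qed.

Lemma fps_mul_t_shift (u v : fps) (k : nat) :
  fps_mul u (fps_mul fps_t v) k.+1 = fps_mul u v k.
Proof.
rewrite {1}/fps_mul big_ord_recr /= subnn fps_mul_t_0 mulr0 addr0.
by apply: eq_bigr => i _; rewrite subSn ?fps_mul_tS // -ltnS.
Qed.

Lemma eq_fps_mul (u v w : fps) : v =1 w -> fps_mul u v =1 fps_mul u w.
Proof. by move=> eqvw k; apply: eq_bigr => i _; rewrite eqvw. Qed.

(** Squaring is the Frobenius map modulo 2: in the convolution the terms of
    index i and 2m - i are equal and cancel in pairs, except the middle one,
    and u_m ^ 2 has the parity of u_m. *)
Lemma fps_sqr_mod2 (u : fps) (m : nat) :
  (fps_mul u u m.*2 = u m %[mod 2])%Z.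
Proof.
pose S := \sum_(0 <= i < m) u i * u (m.*2 - i)%N.
have -> : fps_mul u u m.*2 = S * 2 + u m * u m.
  rewrite /fps_mul -(big_mkord xpredT (fun i => u i * u (m.*2 - i)%N)).
  rewrite (big_cat_nat (n := m)) //=; last by lia.
  rewrite -/S big_ltn; last by lia.
  have -> : (m.*2 - m = m)%N by lia.
  suff -> : \sum_(m.+1 <= i < m.*2.+1) u i * u (m.*2 - i)%N = S.
    by rewrite -/S; ring.
  rewrite big_nat_rev /= /S -{1}[m.+1]add0n big_addn.
  have -> : (m.*2.+1 - m.+1 = m)%N by lia.
  apply: eq_big_nat => i /andP[_ lt_im]; rewrite mulrC.
  by congr (u _ * u _); lia.
rewrite modzMDl -modzMm.
have : (0 <= (u m %% 2)%Z < 2) by rewrite modz_ge0 // ltz_pmod.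
by case: (u m %% 2)%Z => [[|[|k]]|k].
Qed.

Lemma riordan_entry1 (g f : fps) (i : nat) :
  riordan_entry g f i 1 = (g (i - 2)%N == 1 %[mod 2])%Z.
Proof. by rewrite /riordan_entry subnn /= fps_mul1r. Qed.

(** For f = tg the entry in column 2 is a coefficient of the square g^2, shifted
    by t; in even degree it reduces to a coefficient of g, which is an entry in
    column 1. *)
Lemma riordan_entry2_bell (g : fps) (m : nat) : (0 < m)%N ->
  riordan_entry g (fps_mul fps_t g) m.*2.+1 2 =
  riordan_entry g (fps_mul fps_t g) m.+1 1.
Proof.
case: m => // m _; rewrite riordan_entry1 /riordan_entry.
have -> : (m.+1.*2.+1 - 2 = m.*2.+1)%N by lia.
rewrite (eq_fps_mul g (fps_mul1r _)) fps_mul_t_shift fps_sqr_mod2.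
by rewrite !subSS subn0.
Qed.

(** The self-similarity of the odd vertices, read off on labels shifted by one,
    for which the relabelling is halving. *)
Lemma io_entry_double (n : nat) (g f : fps) (i j : nat) :
  io_decomposable n g f -> (j < i)%N -> (i.*2 < n)%N ->
  riordan_entry g f i.*2.+1 j.*2.+1 = riordan_entry g f i.+1 j.+1.
Proof.
move=> [_ [_ _ iso] _] lt_ji lt_in.
have lt_jn : (j.*2 < n)%N by lia.
have := iso (Ordinal lt_in) (Ordinal lt_jn).
rewrite !inE /riordan_graph /label /= !odd_double !doubleK !ltnS.
rewrite ltn_double lt_ji ltn_double !(ltnNge i j) (ltnW lt_ji) /= !orbF.
by move=> ->.
Qed.

(** The vertices of the clique as ordinals, which are labels minus one:
    0, 1, 2, 4, 8, ... Halving the powers of two puts the exceptional 0 in the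
    same increasing sequence as the others. *)
Definition pow2_half (k : nat) : nat := (2 ^ k)./2.

Lemma pow2_halfS k : pow2_half k.+1 = (2 ^ k)%N.
Proof. by rewrite /pow2_half expnS mul2n doubleK. Qed.

Lemma leq_pow2_half : {mono pow2_half : a b / (a <= b)%N}.
Proof.
apply: leq_mono => -[|a] [|b] // lt_ab.
  by rewrite pow2_halfS expn_gt0.
by rewrite !pow2_halfS ltn_exp2l.
Qed.

Lemma ltn_pow2_half : {mono pow2_half : a b / (a < b)%N}.
Proof. exact: leqW_mono leq_pow2_half. Qed.

(** The relabelling lowers both indices by one as long as both vertices are odd
    and above 1. When the smaller vertex is 1 it is fixed, which leads down to
    the adjacency of 1 and 2; when it is 2, [riordan_entry2_bell] replaces it
    by 1. *)
Lemma bell_io_entry_pow2 (n : nat) (g : fps) (a b : nat) :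
  io_decomposable n g (fps_mul fps_t g) ->
  (a < b)%N -> (pow2_half b < n)%N ->
  riordan_entry g (fps_mul fps_t g) (pow2_half b).+1 (pow2_half a).+1.
Proof.
move=> io; have entry0 c : (2 ^ c < n)%N ->
    riordan_entry g (fps_mul fps_t g) (2 ^ c).+1 1.
  elim: c => [_|c IHc].
    by rewrite riordan_entry1; case: io => [[-> _] _ _].
  rewrite expnS mul2n => lt_n; rewrite (io_entry_double (j := 0) io) //.
    by apply: IHc; lia.
  by rewrite expn_gt0.
elim: a b => [|a IHa] [|b] //; first by rewrite pow2_halfS => _; apply: entry0.
case: a IHa => [|a] IHa; case: b => [|b] //.
  rewrite !pow2_halfS expnS mul2n => _ lt_n.
  by rewrite riordan_entry2_bell ?expn_gt0 // entry0 //; lia.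
rewrite ltnS => lt_ab.
rewrite !(pow2_halfS _.+1) !(expnS 2 _) !mul2n -!pow2_halfS => lt_n.
rewrite (io_entry_double io) ?ltn_pow2_half //.
by apply: IHa => //; lia.
Qed.

Lemma bell_io_clique_number_geq (n : nat) (g : fps) :
  (1 <= n)%N -> io_decomposable n g (fps_mul fps_t g) ->
  ((up_log 2 n).+1 <= clique_number (riordan_graph n g (fps_mul fps_t g)))%N.
Proof.
move=> n_gt0 io.
have lt_n (k : 'I_(up_log 2 n).+1) : (pow2_half k < n)%N.
  case: k => -[|k] //=; rewrite pow2_halfS ltnS => lt_k.
  by rewrite ltnNge; apply: contraL lt_k => le_n; rewrite -leqNgt up_log_min.
pose h k := Ordinal (lt_n k).
have h_inj : injective h.
  move=> a b /(congr1 val) /= eq_ab; apply/val_inj.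
  exact: incn_inj leq_pow2_half _ _ eq_ab.
rewrite -[X in (X <= _)%N]card_ord -(card_imset _ h_inj).
apply/clique_leq_number/is_cliqueP => _ _ /imsetP[a _ ->] /imsetP[b _ ->].
rewrite (inj_eq h_inj) /riordan_graph /label /= !ltnS !ltn_pow2_half.
rewrite -val_eqE /= neq_ltn => /orP[] lt_ab; rewrite lt_ab.
  by rewrite (bell_io_entry_pow2 io lt_ab) ?orbT.
by rewrite (bell_io_entry_pow2 io lt_ab).
Qed.

(* [up_log 2 n] is the least e with n <= 2 ^ e, the ceiling of log_2 n. *)
Theorem theorem4p17 (n : nat) (g : fps) (hn : (1 <= n)%N)
    (hio : io_decomposable n g (fps_mul fps_t g)) :
  clique_number (riordan_graph n g (fps_mul fps_t g)) = (up_log 2 n + 1)%N.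
Proof.
apply/eqP; rewrite eqn_leq addn1 io_clique_number_leq //.
exact: bell_io_clique_number_geq.
Qed.
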